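(* For each irrational number $\mu\in[0,\tfrac12]$, the set $\psi^{-1}(\mu)=\{(\alpha,\beta)\in\mathcal P:\psi(\alpha,\beta)=\mu\}$ is connected.
   Context: Let $H_2:[0,1]\to[0,1]$ be $H_2(x)=3x$ on $[0,\frac13]$, $2-3x$ on $[\frac13,\frac23]$, $3x-2$ on $[\frac23,1]$. For $\alpha\ge\beta$ in $[0,1]$ let $\xi^{max}_\alpha=[\frac{\alpha}{3},\frac23-\frac{\alpha}{3}]$, $\xi^{min}_\beta=[\frac23-\frac{\beta}{3},\frac23+\frac{\beta}{3}]$, and define $H_{\alpha,\beta}(x)=\alpha$ on $\xi^{max}_\alpha$, $=\beta$ on $\xi^{min}_\beta$, $=H_2(x)$ elsewhere. For a continuous interval map $f$ and a cycle $P$ of period $q>1$, with $m$ the number of $x\in P$ such that $f(x)-x$ and $f^2(x)-x$ have different signs, the over-rotation number of $P$ is $\frac{m}{2q}$; the over-rotation interval of $f$ is the closure of the set of over-rotation numbers of its cycles, of the form $[r_f,\frac12]$. Let $\mathcal P=\{(\alpha,\beta):\frac12\le\alpha\le1,\ 0\le\beta\le\frac12\}$ (Euclidean metric), and let $\psi:\mathcal P\to[0,\frac12]$ send $(\alpha,\beta)$ to the left endpoint of the over-rotation interval of $H_{\alpha,\beta}$.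
   Formalization: In the over-rotation number, m counts the x in P for which f(x)-x and f^2(x)-f(x) (not f^2(x)-x) have different signs, the standard definition; with f^2(x)-x the over-rotation set need not have closure of the form [r_f,1/2]. *)

(* Defs.v *)
From HB Require Import structures.
From mathcomp Require Import all_boot all_order all_algebra.
From mathcomp Require Import all_classical all_reals all_analysis.
Set Implicit Arguments. Unset Strict Implicit. Unset Printing Implicit Defensive.
Import Order.TTheory GRing.Theory Num.Theory.
Import numFieldNormedType.Exports.
Local Open Scope classical_set_scope.
Local Open Scope ring_scope.

Section Defs.
Variable R : realType.

Definition H2 (x : R) : R :=
  if x <= 1/3 then 3 * x
  else if x <= 2/3 then 2 - 3 * x
  else 3 * x - 2.

Definition ximax (a : R) : set R := `[a / 3, 2/3 - a / 3].
Definition ximin (b : R) : set R := `[2/3 - b / 3, 2/3 + b / 3].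

Definition Hab (a b : R) (x : R) : R :=
  if `[< ximax a x >] then a
  else if `[< ximin b x >] then b
  else H2 x.

Definition is_cycle_point (f : R -> R) (q : nat) (x : R) : Prop :=
  (0 < q)%N /\ iter q f x = x /\ (forall k, (0 < k < q)%N -> iter k f x <> x).

Definition or_count (f : R -> R) (q : nat) (x : R) : nat :=
  count (fun i => let y := iter i f x in (f y - y) * (f (f y) - f y) < 0)
        (iota 0 q).

Definition over_rotation_number (f : R -> R) (q : nat) (x : R) : R :=
  (or_count f q x)%:R / (2 * q)%:R.

Definition over_rotation_numbers (f : R -> R) : set R :=
  [set r | exists (q : nat) (x : R),
      [/\ (1 < q)%N, 0 <= x <= 1, is_cycle_point f q x &
          r = over_rotation_number f q x]].

Definition over_rotation_interval (f : R -> R) : set R :=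
  closure (over_rotation_numbers f).

Definition psi (p : R * R) : R := inf (over_rotation_interval (Hab p.1 p.2)).

Definition Pspace : set (R * R) :=
  [set p | 1/2 <= p.1 <= 1 /\ 0 <= p.2 <= 1/2].


End Defs.

(* Main.v *)
Require Import Defs.
From HB Require Import structures.
From mathcomp Require Import all_boot all_order all_algebra.
From mathcomp Require Import all_classical all_reals all_analysis.
From mathcomp Require Import ring lra.
Set Implicit Arguments. Unset Strict Implicit. Unset Printing Implicit Defensive.
Import Order.TTheory GRing.Theory Num.Theory.
Import numFieldNormedType.Exports.
Local Open Scope classical_set_scope.
Local Open Scope ring_scope.

(* The over-rotation number of a cycle counts its passages across the
   fixed point 1/2.  Measure a point of [[0, 1]] by its side of 1/2 and its
   depth, the distance to the end 0 or 1 of that side, and glue the two sides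
   into a circle traversed once per two passages.  A plateau forces every cycle
   to keep depth at least [l d] on side [d], where [l false = beta] and
   [l true = 1 - alpha], and the lower monotone envelope of the lifted map is a
   continuous degree-one map of the circle.  Lifted cycles run ahead of it, so
   its rotation number rho is a lower bound for the over-rotation numbers.
   Conversely, if rho < p/q < 1/2, raise the depth bounds until the q-th
   iterate first has displacement p at some point: no point of its orbit has a
   flat piece of the envelope immediately to its left, so the orbit is a genuine
   cycle of the original map.  Hence
   psi = rho wherever rho < 1/2.  As rho is continuous, decreasing in alpha and
   increasing in beta, each level set consists of a Lipschitz graph over the
   direction alpha + beta together with segments attached to it, and so is
   connected. *)

(* One step of the lift from depth [u] on side [d]; values above [1/2] are on
   the other side.  This is the lower monotone envelope of the genuine step: it is
   constant below [l d]; the branch from depth [1/6] to the turning point, on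
   which the lift decreases, is replaced by the plateau [1/2 + l (~~ d)]; and
   the last term caps it by the value at the bottom of the other side. *)
Definition half_lift (R : realType) (l : bool -> R) (d : bool) (u : R) : R :=
  Num.max (Num.min (3 * l d) (1/2))
    (Num.min (3 * u)
       (Num.min (Num.max (3 * u - 1/2) (1/2 + l (~~ d))) (1/2 + 3 * l (~~ d)))).

(* The real [c%:R / 2 + u] encodes depth [u] after [c] changes of side. *)
Definition circle_lift (R : realType) (l : bool -> R) (t : R) : R :=
  let c := Num.truncn (2 * t) in c%:R / 2 + half_lift l (odd c) (t - c%:R / 2).

Ltac split_minmax :=
  repeat match goal with
  | |- context [@Order.min ?D ?T ?a ?b] =>
      lazymatch constr:((a, b)) with
      | context [@Order.min] => fail
      | context [@Order.max] => fail
      | _ => case: (leP a b) => ?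
      end
  | |- context [@Order.max ?D ?T ?a ?b] =>
      lazymatch constr:((a, b)) with
      | context [@Order.min] => fail
      | context [@Order.max] => fail
      | _ => case: (leP a b) => ?
      end
  end.

(** The range of the depth bounds [beta] and [1 - alpha] over [Pspace]. *)
Definition admissible (R : realType) (l : bool -> R) :=
  forall d, 0 <= l d <= 1/2.

(** * Monotonicity, Lipschitz bounds and periodicity of the circle lift *)

Section Lift.
Variable R : realType.
Implicit Types (l : bool -> R) (d : bool) (u v t : R).

Let leD_max (x y x' y' e : R) :
  x <= x' + e -> y <= y' + e -> Num.max x y <= Num.max x' y' + e.
Proof. by case: (leP x y); case: (leP x' y'); lra. Qed.

Let leD_min (x y x' y' e : R) :
  x <= x' + e -> y <= y' + e -> Num.min x y <= Num.min x' y' + e.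
Proof. by case: (leP x y); case: (leP x' y'); lra. Qed.

(** Each term under the maxima and minima is affine in one variable with slope between 0 and 3, so
    enlarging all arguments by [e] raises it by at most [3 * e]. The case [e = 0] gives
    monotonicity. *)
Lemma half_lift_lipschitz l l' d u v e : 0 <= e ->
  (forall c, l c <= l' c + e) -> u <= v + e ->
  half_lift l d u <= half_lift l' d v + 3 * e.
Proof.
move=> e0 le uv; have := le d; have := le (~~ d); move=> h1 h2.
rewrite /half_lift; do ?[apply: leD_max | apply: leD_min]; lra.
Qed.

Lemma half_lift_le l l' d u v :
  (forall c, l c <= l' c) -> u <= v -> half_lift l d u <= half_lift l' d v.
Proof.
move=> le uv; have := @half_lift_lipschitz l l' d u v 0 (lexx _).
by rewrite mulr0 !addr0; apply=> // c; rewrite addr0.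
Qed.

Lemma half_lift0 l d u : 0 <= l (~~ d) -> u <= 0 -> 0 <= l d ->
  half_lift l d u = Num.min (3 * l d) (1/2).
Proof.
move=> l0 u0 l1; rewrite /half_lift.
by split_minmax; lra.
Qed.

(** The gluing condition: the top of one side is the bottom of the other, and the two formulas agree
    there. *)
Lemma half_lift_half l d : 0 <= l d -> 0 <= l (~~ d) <= 1/2 ->
  half_lift l d (1/2) = 1/2 + Num.min (3 * l (~~ d)) (1/2).
Proof.
move=> l0 l1; rewrite /half_lift.
have -> : Num.max (3 * (1/2) - 1/2) (1/2 + l (~~ d)) = 1 by rewrite max_l; lra.
by split_minmax; lra.
Qed.


(* The value at a node [c%:R / 2] may be computed in the cell on either side. *)
Lemma liftE l c u : admissible l -> 0 <= u <= 1/2 ->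
  circle_lift l (c%:R / 2 + u) = c%:R / 2 + half_lift l (odd c) u.
Proof.
move=> l0 /andP[u0]; rewrite le_eqVlt => /orP[/eqP ->|u1].
  have -> : c%:R / 2 + 1/2 = c.+1%:R / 2 :> R by lra.
  rewrite /circle_lift; have -> : 2 * (c.+1%:R / 2) = c.+1%:R :> R by lra.
  rewrite natrK subrr half_lift0 ?half_lift_half //= ?negbK;
    try by move: (l0 (odd c)) (l0 (~~ odd c)); lra.
rewrite /circle_lift (_ : Num.truncn _ = c); last first.
  by apply: truncn_def; lra.
by rewrite addrAC subrr add0r.
Qed.

Lemma cellP t : 0 <= t -> exists c u, [/\ 0 <= u < 1/2 & t = c%:R / 2 + u].
Proof.
move=> t0; exists (Num.truncn (2 * t)), (t - (Num.truncn (2 * t))%:R / 2).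
have /truncn_itv : 0 <= 2 * t by lra.
by move=> ?; split; lra.
Qed.

(* For negative [t] the truncation is [0] and [circle_lift] is constant. *)
Lemma lift_neg l t : admissible l -> t <= 0 -> circle_lift l t = circle_lift l 0.
Proof.
move=> l0 t0; rewrite /circle_lift mulr0 truncn0.
have -> : Num.truncn (2 * t) = 0%N by apply/truncn0Pn; rewrite -ltNge; lra.
by rewrite !half_lift0 //; try lra; have := l0 true; have := l0 false; lra.
Qed.

(** These increment bounds add up over adjacent intervals, so they are proved within a cell, then
    between nodes, then in general. *)
Let mono_lip l (s t : R) :=
  0 <= circle_lift l t - circle_lift l s <= 3 * (t - s).

Let mono_lip_trans l s t r : mono_lip l s t -> mono_lip l t r -> mono_lip l s r.
Proof. by rewrite /mono_lip; lra. Qed.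

Let mono_lip_cell l c u v : admissible l -> 0 <= u -> u <= v -> v <= 1/2 ->
  mono_lip l (c%:R / 2 + u) (c%:R / 2 + v).
Proof.
move=> l0 u0 uv v1; rewrite /mono_lip !liftE //; try lra.
have le1 := @half_lift_le l l (odd c) u v (fun _ => lexx _) uv.
have le2 : half_lift l (odd c) v <= half_lift l (odd c) u + 3 * (v - u).
  by apply: half_lift_lipschitz => [|d|]; lra.
by lra.
Qed.

Let mono_lip_node l c n : admissible l ->
  mono_lip l (c%:R / 2) ((c + n)%:R / 2).
Proof.
move=> l0; elim: n => [|n IH]; first by rewrite addn0 /mono_lip; lra.
apply: mono_lip_trans IH _.
have := @mono_lip_cell l (c + n) 0 (1/2) l0 (lexx _).
rewrite addr0 (_ : _ + 1/2 = (c + n.+1)%:R / 2); last first.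
  by rewrite addnS; lra.
by apply; lra.
Qed.

Let mono_lip_le l s t : admissible l -> s <= t -> mono_lip l s t.
Proof.
move=> l0 st.
have [t0|t0] := leP t 0.
  by rewrite /mono_lip !(@lift_neg l) //; lra.
wlog s0 : s st / 0 <= s.
  move=> W; have [|s0] := leP 0 s; first exact: W.
  have := W 0; rewrite /mono_lip (@lift_neg l s l0 (ltW s0)) => /(_ (ltW t0) (lexx _)).
  by lra.
have [c [u [u0 es]]] := cellP s0; have [c' [u' [u0' et]]] := cellP (ltW t0).
have cc : (c <= c')%N.
  rewrite leqNgt; apply/negP => cc.
  have : c'.+1%:R <= c%:R :> R by rewrite ler_nat.
  by lra.
rewrite es et; move: cc; rewrite leq_eqVlt => /orP[/eqP cc|cc].
  by subst c'; apply: mono_lip_cell => //; lra.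
have := @mono_lip_cell l c u (1/2) l0.
rewrite (_ : _ + 1/2 = c.+1%:R / 2); last by lra.
move=> H; apply: mono_lip_trans (H _ _ _) _; [lra|lra|lra|].
have := @mono_lip_node l c.+1 (c' - c.+1) l0; rewrite subnKC // => H'.
apply: mono_lip_trans H' _.
have := @mono_lip_cell l c' 0 u' l0 (lexx _); rewrite addr0.
by apply; lra.
Qed.

Lemma lift_homo l s t : admissible l -> s <= t -> circle_lift l s <= circle_lift l t.
Proof. by move=> l0 /(mono_lip_le l0); rewrite /mono_lip; lra. Qed.

Lemma lift_lipschitz l s t : admissible l ->
  `|circle_lift l s - circle_lift l t| <= 3 * `|s - t|.
Proof.
move=> l0; wlog st : s t / s <= t.
  move=> W; case: (leP s t) => [|/ltW]; first exact: W.
  by rewrite distrC (distrC s); exact: W.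
have := mono_lip_le l0 st; rewrite /mono_lip => ?.
by rewrite distrC (distrC s) !ger0_norm; lra.
Qed.

Lemma lift_param_le l l' t : (forall d, l d <= l' d) ->
  circle_lift l t <= circle_lift l' t.
Proof. by move=> le; rewrite /circle_lift lerD2l half_lift_le. Qed.

Lemma lift_param_lipschitz l l' t e : 0 <= e -> (forall d, `|l d - l' d| <= e) ->
  `|circle_lift l t - circle_lift l' t| <= 3 * e.
Proof.
move=> e0 le; rewrite /circle_lift.
set d := odd _; set u := t - _.
have h1 : half_lift l d u <= half_lift l' d u + 3 * e.
  apply: half_lift_lipschitz => //; last by lra.
  by move=> c; move: (le c); rewrite ler_norml; lra.
have h2 : half_lift l' d u <= half_lift l d u + 3 * e.
  apply: half_lift_lipschitz => //; last by lra.
  by move=> c; move: (le c); rewrite ler_norml; lra.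
by rewrite ler_norml; lra.
Qed.

Lemma lift_periodic l t n : admissible l -> 0 <= t ->
  circle_lift l (t + n%:R) = circle_lift l t + n%:R.
Proof.
move=> l0 t0; have [c [u [u0 ->]]] := cellP t0.
have -> : c%:R / 2 + u + n%:R = (c + n.*2)%:R / 2 + u.
  by rewrite natrD -mul2n natrM; lra.
rewrite !liftE //; try lra.
by rewrite oddD odd_double addbF natrD -mul2n natrM; lra.
Qed.

Lemma lift_ge_node l c t : admissible l -> c%:R / 2 <= t ->
  c%:R / 2 <= circle_lift l t.
Proof.
move=> l0 ct; apply: le_trans (lift_homo l0 ct).
rewrite -[X in circle_lift l X]addr0 liftE ?half_lift0 ?lexx //=;
  try by move: (l0 (odd c)) (l0 (~~ odd c)); lra.
by have := l0 (odd c); split_minmax; lra.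
Qed.

End Lift.

(** * The rotation number of the lift and its continuity in the depth bounds *)

Definition rotation_number (R : realType) (l : bool -> R) : R :=
  inf [set x | exists2 n, (0 < n)%N & x = (iter n (circle_lift l) 0 + 1) / n%:R].

Section RotationNumber.
Variable R : realType.
Implicit Types (l : bool -> R) (s t : R).

Lemma lift_ge0 l t : admissible l -> 0 <= t -> 0 <= circle_lift l t.
Proof. by move=> l0 t0; have := @lift_ge_node R l 0 t l0; rewrite mul0r; apply. Qed.

Lemma iter_lift_ge0 l n t : admissible l -> 0 <= t -> 0 <= iter n (circle_lift l) t.
Proof. by move=> l0 t0; elim: n => //= n; exact: lift_ge0. Qed.

Lemma iter_lift_homo l n s t : admissible l -> s <= t ->
  iter n (circle_lift l) s <= iter n (circle_lift l) t.
Proof. by move=> l0 st; elim: n => //= n; exact: lift_homo. Qed.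

Lemma iter_lift_param_le l l' n t : admissible l -> (forall d, l d <= l' d) ->
  iter n (circle_lift l) t <= iter n (circle_lift l') t.
Proof.
move=> l0 le; elim: n => //= n IH.
exact: le_trans (lift_homo l0 IH) (lift_param_le _ le).
Qed.

Lemma iter_lift_periodic l n t m : admissible l -> 0 <= t ->
  iter n (circle_lift l) (t + m%:R) = iter n (circle_lift l) t + m%:R.
Proof.
by move=> l0 t0; elim: n => //= n ->; rewrite lift_periodic ?iter_lift_ge0.
Qed.

Lemma iter_lift_lipschitz l n s t : admissible l ->
  `|iter n (circle_lift l) s - iter n (circle_lift l) t| <= 3 ^+ n * `|s - t|.
Proof.
move=> l0; elim: n => [|n IH] /=; first by rewrite expr0 mul1r.
have := @lift_lipschitz R l (iter n (circle_lift l) s) (iter n (circle_lift l) t) l0.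
by move=> /le_trans; apply; rewrite exprS -mulrA ler_pM2l.
Qed.

Lemma iter_lift_param_lipschitz l l' n t e : admissible l' -> 0 <= e ->
  (forall d, `|l d - l' d| <= e) ->
  `|iter n (circle_lift l) t - iter n (circle_lift l') t| <= 4 ^+ n * e.
Proof.
move=> l0 e0 le.
(* Subtracting 1 closes the induction: [3 * (4 ^+ n - 1) + 3 <= 4 ^+ n.+1 - 1]. *)
suff : `|iter n (circle_lift l) t - iter n (circle_lift l') t| <= (4 ^+ n - 1) * e by lra.
elim: n => [|n IH] /=; first by rewrite expr0 subrr normr0 subrr mul0r.
have := lift_lipschitz (iter n (circle_lift l) t) (iter n (circle_lift l') t) l0.
have := lift_param_lipschitz (iter n (circle_lift l) t) e0 le.
have : 1 <= 4 ^+ n :> R by apply: exprn_ege1; lra.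
set x := iter n _ t in IH *; set y := iter n _ t in IH *.
move=> h h1 h2; have := ler_distD (circle_lift l' x) (circle_lift l x) (circle_lift l' y).
have : 1 * e <= 4 ^+ n * e by apply: ler_wpM2r.
by rewrite exprS; move: (4 ^+ n) IH h h1 h2 => z; lra.
Qed.

Lemma iter_le_shift (f : R -> R) q K n t : (forall s, 0 <= s -> 0 <= f s) ->
  (forall s, 0 <= s -> iter q f s <= s + K) -> 0 <= t ->
  iter (n * q) f t <= t + n%:R * K.
Proof.
move=> f0 fK t0; elim: n => [|n IH]; first by rewrite mul0n mul0r addr0.
rewrite mulSn iterD.
have /fK : 0 <= iter (n * q) f t by elim: (n * q)%N => //= k; exact: f0.
by rewrite -natr1; lra.
Qed.

Lemma iter_ge_shift (f : R -> R) q K n t : (forall s, 0 <= s -> 0 <= f s) ->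
  (forall s, 0 <= s -> s + K <= iter q f s) -> 0 <= t ->
  t + n%:R * K <= iter (n * q) f t.
Proof.
move=> f0 fK t0; elim: n => [|n IH]; first by rewrite mul0n mul0r addr0.
rewrite mulSn iterD.
have /fK : 0 <= iter (n * q) f t by elim: (n * q)%N => //= k; exact: f0.
by rewrite -natr1; lra.
Qed.

(** [t] lies between consecutive integers, whose orbits are translates of the orbit of [0]. Hence
    [iter n (circle_lift l) 0 + 1] is subadditive in [n], and the infimum [rotation_number] is the
    usual limit. *)
Lemma iter_lift_bounds l n t : admissible l -> 0 <= t ->
  t + (iter n (circle_lift l) 0 - 1) <= iter n (circle_lift l) t
    <= t + (iter n (circle_lift l) 0 + 1).
Proof.
move=> l0 t0; have /andP[tl tu] := truncn_itv t0.
have := iter_lift_homo n l0 tl; have := iter_lift_homo n l0 (ltW tu).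
have e m : iter n (circle_lift l) m%:R = iter n (circle_lift l) 0 + m%:R.
  by rewrite -iter_lift_periodic // add0r.
by move: tl tu; rewrite !e -natr1; lra.
Qed.

(** Both quotients are compared with the displacement of [0] in [m * n] steps, cut into blocks of
    length [n] or of length [m]. *)
Lemma rotation_number_lower_bound l n m : admissible l -> (0 < n)%N -> (0 < m)%N ->
  (iter n (circle_lift l) 0 - 1) / n%:R <= (iter m (circle_lift l) 0 + 1) / m%:R.
Proof.
move=> l0 n0 m0; rewrite ler_pdivrMr ?ltr0n// mulrAC ler_pdivlMr ?ltr0n//.
have h1 : 0 + m%:R * (iter n (circle_lift l) 0 - 1)
    <= iter (m * n) (circle_lift l) 0.
  apply: iter_ge_shift => // s s0; first exact: lift_ge0.
  by case/andP: (iter_lift_bounds n l0 s0).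
have h2 : iter (n * m) (circle_lift l) 0
    <= 0 + n%:R * (iter m (circle_lift l) 0 + 1).
  apply: iter_le_shift => // s s0; first exact: lift_ge0.
  by case/andP: (iter_lift_bounds m l0 s0).
by move: h1 h2; rewrite mulnC; lra.
Qed.

Let rotation_set l :=
  [set x | exists2 n, (0 < n)%N & x = (iter n (circle_lift l) 0 + 1) / n%:R].

Let rotation_set_lb l x : (forall n, (0 < n)%N ->
   x <= (iter n (circle_lift l) 0 + 1) / n%:R) -> lbound (rotation_set l) x.
Proof. by move=> h y [n n0 ->]; exact: h. Qed.

Let rotation_set_neq0 l : rotation_set l !=set0.
Proof. by exists ((iter 1 (circle_lift l) 0 + 1) / 1%:R), 1%N. Qed.

Lemma rotation_number_le l n : admissible l -> (0 < n)%N ->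
  rotation_number l <= (iter n (circle_lift l) 0 + 1) / n%:R.
Proof.
move=> l0 n0; apply: ge_inf; last by exists n.
exists ((iter 1 (circle_lift l) 0 - 1) / 1%:R); apply: rotation_set_lb => m.
exact: rotation_number_lower_bound.
Qed.

Lemma rotation_number_ge l x : (forall n, (0 < n)%N ->
   x <= (iter n (circle_lift l) 0 + 1) / n%:R) -> x <= rotation_number l.
Proof. by move=> /rotation_set_lb; apply: lb_le_inf. Qed.

Lemma rotation_number_le_orbit l q p t : admissible l -> (0 < q)%N -> 0 <= t ->
  iter q (circle_lift l) t <= t + p%:R -> rotation_number l <= p%:R / q%:R.
Proof.
move=> l0 q0 t0 tp.
have tk k : iter (k * q) (circle_lift l) t <= t + (k * p)%:R.
  elim: k => [|k IH]; first by rewrite !mul0n addr0.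
  rewrite !mulSn iterD (le_trans (iter_lift_homo q l0 IH)) //.
  by rewrite iter_lift_periodic // natrD; lra.
apply/ler_addgt0Pr => e e0.
(* Over [k] periods the constants [t] and [1] cost [(t + 1) / (k * q)], which this [k] makes smaller
   than [e]. *)
pose k := (Num.truncn ((t + 1) / e)).+1.
have q0' : 0 < q%:R :> R by rewrite ltr0n.
have q1 : 1 <= q%:R :> R by rewrite ler1n.
have kq0 : (0 < k * q)%N by rewrite muln_gt0.
apply: le_trans (rotation_number_le l0 kq0) _.
rewrite ler_pdivrMr ?ltr0n//.
have : iter (k * q) (circle_lift l) 0 <= t + (k * p)%:R.
  exact: le_trans (iter_lift_homo _ l0 t0) (tk k).
have : t + 1 < e * k%:R by rewrite mulrC -ltr_pdivrMr // truncnS_gt.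
have -> : (p%:R / q%:R + e) * (k * q)%:R = (k * p)%:R + e * k%:R * q%:R.
  by rewrite !natrM; field; rewrite gt_eqF.
have : 0 < e * k%:R by rewrite mulr_gt0.
have : e * k%:R * 1 <= e * k%:R * q%:R by rewrite ler_pM2l ?mulr_gt0.
by lra.
Qed.

Lemma rotation_number_ge_orbit l q p t : admissible l -> (0 < q)%N -> 0 <= t ->
  t + p%:R <= iter q (circle_lift l) t -> p%:R / q%:R <= rotation_number l.
Proof.
move=> l0 q0 t0 tp; apply: rotation_number_ge => n n0.
have tk k : t + (k * p)%:R <= iter (k * q) (circle_lift l) t.
  elim: k => [|k IH]; first by rewrite !mul0n addr0.
  rewrite !mulSn iterD (le_trans _ (iter_lift_homo q l0 IH)) //.
  by rewrite iter_lift_periodic // natrD; lra.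
have := tk n; rewrite ler_pdivrMr ?ltr0n// mulrAC ler_pdivlMr ?ltr0n//.
have : iter (q * n) (circle_lift l) t
    <= t + q%:R * (iter n (circle_lift l) 0 + 1).
  apply: iter_le_shift => // s s0; first exact: lift_ge0.
  by case/andP: (iter_lift_bounds n l0 s0).
by rewrite mulnC natrM; lra.
Qed.

Lemma rotation_number_homo l l' : admissible l -> admissible l' ->
  (forall d, l d <= l' d) -> rotation_number l <= rotation_number l'.
Proof.
move=> l0 l0' le; apply: rotation_number_ge => n n0.
apply: le_trans (rotation_number_le l0 n0) _.
by rewrite ler_pM2r ?invr_gt0 ?ltr0n// lerD2r iter_lift_param_le.
Qed.

(** The [n]-th iterate of [0] is within 1 of [n] times the rotation number, uniformly in [l]. With
    [n] fixed, close parameters move that iterate by at most 1, for a total error of [3 / n < e]. *)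
Lemma rotation_number_continuous (e : R) : 0 < e -> exists2 dl : R, 0 < dl &
  forall l l', admissible l -> admissible l' -> (forall d, `|l d - l' d| <= dl) ->
  `|rotation_number l - rotation_number l'| < e.
Proof.
move=> e0; pose n := (Num.truncn (4 / e)).+1.
have n0 : (0 < n)%N by [].
have ne : 4 < n%:R * e by rewrite -ltr_pdivrMr // truncnS_gt.
have p4 : 0 < 4 ^+ n :> R by rewrite exprn_gt0.
exists (4 ^+ n)^-1; first by rewrite invr_gt0.
move=> l l' l0 l0' le.
have := iter_lift_param_lipschitz n 0 l0' (ltW _) le.
rewrite invr_gt0 mulfV ?gt_eqF// => /(_ p4).
have bnd (h : bool -> R) : admissible h ->
    iter n (circle_lift h) 0 - 1 <= n%:R * rotation_number h
      <= iter n (circle_lift h) 0 + 1.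
  move=> h0; apply/andP; split; rewrite mulrC.
    rewrite -ler_pdivrMr ?ltr0n//; apply: rotation_number_ge => m.
    exact: rotation_number_lower_bound.
  by rewrite -ler_pdivlMr ?ltr0n// rotation_number_le.
move: (bnd _ l0) (bnd _ l0'); rewrite ler_norml => b1 b2 b3.
have n0' : 0 < n%:R :> R by rewrite ltr0n.
rewrite -(ltr_pM2l n0') -{1}(ger0_norm (ltW n0')) -normrM mulrBr ltr_norml.
by lra.
Qed.

End RotationNumber.

(* [place d u] is the point of [[0, 1]] at distance [u] from the endpoint [0]
   (if [d = false]) or [1] (if [d = true]); [u] ranges over [[0, 1/2]]. *)
Definition place (R : realType) (d : bool) (u : R) : R := if d then 1 - u else u.

Definition fold_map (R : realType) (l : bool -> R) : R -> R :=
  Hab (1 - l true) (l false).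

(* A point entering side [d] at depth at least [l d] comes from depth at least
   [l (~~ d)], hence enters no closer to the end than [3 * l (~~ d) - 1]. *)
Definition core (R : realType) (l : bool -> R) (d : bool) : R :=
  Num.max (l d) (3 * l (~~ d) - 1).

Definition is_recurrent (R : realType) (f : R -> R) (y : R) : Prop :=
  [/\ 0 <= y <= 1, f y <> y & exists2 q, (0 < q)%N & iter q f y = y].

(** * The interval map in side and depth coordinates; the lower bound on over-rotation numbers *)

Section FoldMap.
Variable R : realType.
Implicit Types (l : bool -> R) (d : bool) (u v x y : R).

Let HabE (a b x : R) : Hab a b x =
  if a / 3 <= x <= 2/3 - a / 3 then a
  else if 2/3 - b / 3 <= x <= 2/3 + b / 3 then b else H2 x.
Proof.
have E (c d : R) : `[< `[c, d]%classic x >] = (c <= x <= d).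
  by apply/asboolP/idP; rewrite /= in_itv.
by rewrite /Hab /ximax /ximin !E.
Qed.

Lemma fold_mapE l d u : admissible l -> 0 <= u <= 1/2 ->
  fold_map l (place d u) =
  place d (Num.min (3 * u) (Num.min (2 - 3 * u) (1 - l (~~ d)))).
Proof.
move=> l0 u0; have := l0 true; have := l0 false => lf lt.
rewrite /fold_map HabE /H2 /place; case: d => /=;
  do ![case: ifP => ?]; split_minmax; lra.
Qed.

(** Interior points of a side move in the direction of [1/2], so the sign of the displacement
    identifies the side and [or_count] counts changes of side. *)
Lemma fold_map_gt l d u : admissible l -> 0 < u < 1/2 ->
  (0 < fold_map l (place d u) - place d u) = ~~ d /\
  (fold_map l (place d u) - place d u < 0) = d.
Proof.
move=> l0 u0; rewrite fold_mapE //; last by lra.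
suff : u < Num.min (3 * u) (Num.min (2 - 3 * u) (1 - l (~~ d))).
  by move: (Num.min _ _) => v; rewrite /place; case: d => /= ?;
    split; apply/idP; rewrite -?leNgt; lra.
by have := l0 (~~ d); rewrite !lt_min; lra.
Qed.

Lemma fold_map_fixed l d u : admissible l -> u = 0 \/ u = 1/2 ->
  fold_map l (place d u) = place d u.
Proof.
move=> l0; have ? := l0 (~~ d).
by case=> ->; rewrite fold_mapE //; try lra; congr place; split_minmax; lra.
Qed.

Lemma place_inj d d' u u' : 0 < u < 1/2 -> 0 < u' < 1/2 ->
  place d u = place d' u' -> d = d' /\ u = u'.
Proof.
by move=> u0 u0'; rewrite /place; case: d; case: d' => h; split=> //; lra.
Qed.

Lemma placeP y : 0 <= y <= 1 -> exists d u, 0 <= u <= 1/2 /\ y = place d u.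
Proof.
move=> y01; have [?|?] := leP y (1/2); first by exists false, y; rewrite /place; lra.
by exists true, (1 - y); rewrite /place; lra.
Qed.

Lemma fold_map_bounded l y : admissible l -> 0 <= y <= 1 -> 0 <= fold_map l y <= 1.
Proof.
move=> l0 /placeP[d [u [u0 ->]]]; rewrite fold_mapE // /place.
by move: (l0 (~~ d)); case: d => /= ?; split_minmax; lra.
Qed.

Lemma crossingE l d d' u u' : admissible l -> 0 < u < 1/2 -> 0 < u' < 1/2 ->
  let f := fold_map l in let y := place d u in f y = place d' u' ->
  ((f y - y) * (f (f y) - f y) < 0) = (d != d').
Proof.
move=> l0 u0 u0' f y fy.
have [yp yn] : (0 < f y - y) = ~~ d /\ (f y - y < 0) = d := fold_map_gt d l0 u0.
have [zp zn] := fold_map_gt d' l0 u0'; rewrite -fy -/f in zp zn.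
move: (f y - y) (f (f y) - f y) yp yn zp zn => r s.
clear fy y; case: d; case: d' => /= *; apply/idP; rewrite -?leNgt; nra.
Qed.

Lemma or_countS (f : R -> R) n x : let y := iter n f x in
  or_count f n.+1 x = (or_count f n x + ((f y - y) * (f (f y) - f y) < 0)%R)%N.
Proof. by rewrite /or_count -addn1 iotaD count_cat /= addn0 add0n. Qed.

Lemma fold_map_step l d d' u u' : admissible l -> 0 < u < 1/2 -> 0 < u' < 1/2 ->
  fold_map l (place d u) = place d' u' ->
  d' = d /\ u' = 3 * u \/
  d' = ~~ d /\ u' = Num.max (1 - 3 * u) (Num.max (3 * u - 1) (l (~~ d))).
Proof.
move=> l0 u0 u0'; rewrite fold_mapE //; last by lra.
move: (l0 (~~ d)); rewrite /place; case: d'; case: d => /= ?;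
  split_minmax => h; (left; split=> //; lra) || (right; split=> //; lra).
Qed.

Lemma recurrent_step l y : admissible l -> is_recurrent (fold_map l) y ->
  is_recurrent (fold_map l) (fold_map l y).
Proof.
move=> l0 [y01 fy [q q0 qy]]; split; first exact: fold_map_bounded.
- move=> ffy; apply: fy; rewrite -[in RHS]qy -(prednK q0) iterSr.
  by elim: q.-1 => //= n <-; rewrite ffy.
- by exists q; rewrite // -iterSr iterS qy.
Qed.

Lemma recurrent_iter l n y : admissible l -> is_recurrent (fold_map l) y ->
  is_recurrent (fold_map l) (iter n (fold_map l) y).
Proof. by move=> l0 ry; elim: n => //= n; exact: recurrent_step. Qed.

Lemma recurrent_place l y : admissible l -> is_recurrent (fold_map l) y ->
  exists d u, 0 < u < 1/2 /\ y = place d u.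
Proof.
move=> l0 [/placeP[d [u [u01 yE]]] fy _]; exists d, u; split=> //.
have h0 : u <> 0 by move=> u0; apply: fy; rewrite yE fold_map_fixed //; left.
have h1 : u <> 1/2 by move=> u0; apply: fy; rewrite yE fold_map_fixed //; right.
have /andP[a b] := u01; rewrite !lt_neqAle a b eq_sym.
by move/eqP: h0 => ->; move/eqP: h1 => ->.
Qed.

(* Backwards from a point of depth [< L d] the orbit cannot have crossed, so
   the depth was divided by [3] at each step, against recurrence. *)
Lemma recurrent_lower_bound l (L : bool -> R) : admissible l ->
  (forall y d u u', is_recurrent (fold_map l) y -> y = place d u ->
     0 < u < 1/2 -> 0 < u' < 1/2 -> fold_map l y = place (~~ d) u' ->
     L (~~ d) <= u') ->
  forall y d u, is_recurrent (fold_map l) y -> y = place d u -> 0 < u < 1/2 ->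
  L d <= u.
Proof.
move=> l0 LP y d u ry yE u0; rewrite leNgt; apply/negP => uL.
have key n e w : iter n (fold_map l) y = place e w -> 0 < w < 1/2 -> w < L e ->
    w = 3 ^+ n * u.
  elim: n e w => [|n IH] e w /=.
    by rewrite yE => yw w0 _; have [_ ->] := place_inj u0 w0 yw; rewrite mul1r.
  have rn := recurrent_iter n l0 ry.
  have [e' [w' [w0' nE]]] := recurrent_place l0 rn.
  move=> fn w0 wL.
  have st : fold_map l (place e' w') = place e w by rewrite -nE.
  case: (fold_map_step l0 w0' w0 st) => [[ee ww]|[ee _]].
    by rewrite ww (IH e' w') //; subst e; [rewrite exprS; lra|lra].
  subst e; have := LP _ _ _ _ rn nE w0' w0 fn; lra.
have [_ _ [q q0 qy]] := ry.
have := key q d u; rewrite qy => /(_ yE u0 uL).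
have : 1 < 3 ^+ q :> R by rewrite exprn_egt1 ?lt0n_neq0 //; lra.
by nra.
Qed.

(** Two rounds of [recurrent_lower_bound]: the plateau gives depth at least [l], and this bound at
    the preimage then improves the depth after a crossing to [core]. *)
Lemma core_lower_bound l y d u : admissible l -> is_recurrent (fold_map l) y ->
  y = place d u -> 0 < u < 1/2 -> core l d <= u.
Proof.
move=> l0; apply: (recurrent_lower_bound l0) => {}y {}d {}u u' ry yE u0 u0' fy.
have lu : l d <= u.
  apply: (recurrent_lower_bound l0 _ ry yE u0) => z e w w' rz zE w0 w0'.
  rewrite zE => /(fold_map_step l0 w0 w0')[[]|[_ ->]]; first by case: e {zE}.
  by rewrite !le_max lexx !orbT.
move: fy; rewrite yE => /(fold_map_step l0 u0 u0')[[]|[_ ->]]; first by case: d {yE lu}.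
rewrite /core negbK; move: (l0 d) (l0 (~~ d)); split_minmax; lra.
Qed.

Lemma core_admissible l : admissible l -> admissible (core l).
Proof. by move=> l0 d; move: (l0 d) (l0 (~~ d)); rewrite /core; split_minmax; lra. Qed.

(** Induction on [n]: monotonicity of the envelope carries the inequality to the next step, where
    the envelope at the genuine point lies below its genuine image. *)
Lemma orbit_lift_le l d0 u0 x n : admissible l -> is_recurrent (fold_map l) x ->
  x = place d0 u0 -> 0 < u0 < 1/2 ->
  let c := (d0 + or_count (fold_map l) n x)%N in
  exists u, [/\ 0 < u < 1/2, iter n (fold_map l) x = place (odd c) u &
    iter n (circle_lift (core l)) (d0%:R / 2 + u0) <= c%:R / 2 + u].
Proof.
move=> l0 rx xE u0P; elim: n => [|n [u [u01 nE IH]]].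
  by exists u0; rewrite /or_count /= addn0 oddb.
move: IH nE; rewrite or_countS.
set c := (d0 + or_count _ n x)%N => IH nE.
have rn := recurrent_iter n l0 rx.
have [d' [u' [u01' fE]]] := recurrent_place l0 (recurrent_step l0 rn).
have cL := core_lower_bound l0 rn nE u01.
have fE' : fold_map l (place (odd c) u) = place d' u' by rewrite -nE.
have st := fold_map_step l0 u01 u01' fE'.
have := crossingE l0 u01 u01' fE'; rewrite /= -nE => ->.
rewrite addnA -/c.
have La := core_admissible l0.
have := lift_homo La IH; rewrite liftE //; last by lra.
move=> le; exists u'; split=> //.
  by rewrite /= fE; congr place; rewrite oddD oddb; case: (d') (odd c) => -[].
apply: le_trans le _; rewrite natrD mulrDl -addrA lerD2l.
have ? := La (odd c); have ? := La (~~ odd c).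
(* Without a crossing the image is [3 * u], which bounds both arguments of the outer maximum. After
   a crossing it is [1/2 + u'], and [u'] bounds both [3 * u - 1] and [core l] on the new side. *)
case: st => -[dE uE]; rewrite dE.
  rewrite eqxx /= mul0r add0r uE /half_lift ge_max !ge_min lexx andbT.
  by apply/orP; left; lra.
rewrite (_ : odd c != ~~ odd c); last by case: (odd c).
have : core l (~~ odd c) <= u'.
  by apply: (core_lower_bound l0 (recurrent_step l0 rn) _ u01'); rewrite -dE.
have : 3 * u - 1 <= u' by rewrite uE !le_max lexx orbT.
move=> h1 h2; rewrite /half_lift ge_max !ge_min ge_max /=.
by apply/andP; split; apply/orP; right; [|apply/orP; left; apply/andP; split]; lra.
Qed.

Lemma over_rotation_ge l q x : admissible l -> (1 < q)%N -> 0 <= x <= 1 ->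
  is_cycle_point (fold_map l) q x ->
  rotation_number (core l) <= over_rotation_number (fold_map l) q x.
Proof.
move=> l0 q1 x01 [q0 [qx minq]].
have rx : is_recurrent (fold_map l) x.
  by split=> //; [have := minq 1%N q1 | exists q].
have [d0 [u0 [u01 xE]]] := recurrent_place l0 rx.
have [u [uP]] := orbit_lift_le q l0 rx xE u01.
rewrite qx {1}xE => /(place_inj u01 uP)[dE uE] le; subst u.
(* A cycle returns to its side, so it crosses an even number [2 * k] of times and its lift advances
   by [k]. *)
have ev : ~~ odd (or_count (fold_map l) q x).
  by move: dE; rewrite oddD oddb; case: d0 {xE le}; case: odd.
have {ev} := even_halfK ev; set k := _./2 => kE.
rewrite /over_rotation_number -kE -mul2n !natrM.
have -> : 2 * k%:R / (2 * q%:R) = k%:R / q%:R :> R.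
  by rewrite invfM mulrACA divff ?mul1r.
apply: (@rotation_number_le_orbit _ _ q k (d0%:R / 2 + u0)) => //.
- exact: core_admissible.
- by rewrite addr_ge0 ?divr_ge0 ?ler0n //; lra.
- by move: le; rewrite -kE -mul2n natrD natrM; lra.
Qed.

End FoldMap.

Lemma lipschitz_continuous (R : realType) (f : R -> R) (k : R) :
  (forall x y, `|f x - f y| <= k * `|x - y|) -> continuous f.
Proof.
move=> fk x; apply/cvgrPdist_lt => e e0.
have k0 : 0 < `|k| + 1 by have := normr_ge0 k; lra.
near=> y.
apply: le_lt_trans (fk x y) _.
have : `|x - y| < e / (`|k| + 1).
  by near: y; apply: cvgr_dist_lt; rewrite ?divr_gt0.
rewrite ltr_pdivlMr // => h.
have := ler_norm k; have := normr_ge0 (x - y); nra.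
Unshelve. all: by end_near.
Qed.

(** * Raising the depth bounds to a first touch *)

Section Touch.
Variable R : realType.
Implicit Types (l : bool -> R) (d : bool) (s t u v : R).

Definition raise l s d : R := Num.max (l d) s.

Lemma raise_admissible l s : admissible l -> 0 <= s <= 1/6 -> admissible (raise l s).
Proof. by move=> l0 s0 d; move: (l0 d); rewrite /raise; split_minmax; lra. Qed.

Let raise_lipschitz l s s' d : `|raise l s d - raise l s' d| <= `|s - s'|.
Proof.
have := ler_norm (s - s'); have := ler_norm (s' - s); rewrite (distrC s' s) => h1 h2.
by rewrite /raise ler_norml; split_minmax; lra.
Qed.

(** With bounds at least [1/6] the bottom of a side already jumps to the next node; hence raising up
    to [1/6] always reaches displacement [q / 2 >= p]. *)
Lemma iter_lift_ge_half l n c : admissible l -> (forall d, 1/6 <= l d) ->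
  (c + n)%:R / 2 <= iter n (circle_lift l) (c%:R / 2).
Proof.
move=> l0 l6; elim: n => [|n IH] /=; first by rewrite addn0.
apply: le_trans (lift_homo l0 IH).
rewrite -[X in circle_lift l X]addr0 liftE //; last by lra.
set d := odd _; rewrite half_lift0 //; last 2 first.
  by have := l0 (~~ d); lra.
  by have := l0 d; lra.
by have := l6 d; rewrite addnS; split_minmax; lra.
Qed.

(* Raising the parameters until the displacement of the [q]-th iterate first
   reaches [p]. *)
Lemma first_touch l p q : admissible l -> (0 < q)%N -> (p.*2 <= q)%N ->
  rotation_number l < p%:R / q%:R ->
  exists s t, let G := circle_lift (raise l s) in
  [/\ 0 <= s <= 1/6, 1 <= t, iter q G t = t + p%:R &
      forall v, 0 <= v -> iter q G v <= v + p%:R].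
Proof.
move=> l0 q0 pq rho.
pose G s := circle_lift (raise l s); pose h s t := iter q (G s) t - t - p%:R.
have p4 : 0 < 4 ^+ q :> R by rewrite exprn_gt0.
have ha s : 0 <= s <= 1/6 -> admissible (raise l s) by exact: raise_admissible.
have hs s s' t : 0 <= s' <= 1/6 -> h s t <= h s' t + 4 ^+ q * `|s - s'|.
  move=> s0.
  have := iter_lift_param_lipschitz q t (ha _ s0) (normr_ge0 _) (raise_lipschitz l s s').
  by rewrite /h /G ler_norml; lra.
(* One period of starting points suffices; it begins at [1] to keep the touching orbit away from the
   node [0], which has no cell on its left. *)
pose S := [set s | 0 <= s <= 1/6 /\ exists2 t, 1 <= t <= 2 & 0 <= h s t].
have S6 : S (1/6).
  split; first by lra.
  exists 1; first by lra.
  have := @iter_lift_ge_half (raise l (1/6)) q 2; rewrite divff // => H.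
  have {H} : (2 + q)%:R / 2 <= iter q (G (1/6)) 1.
    apply: H => [|d]; first by apply: ha; lra.
    by rewrite le_max lexx orbT.
  move: pq; rewrite -(ler_nat R) -mul2n natrM /h natrD; lra.
have Slb : lbound S 0 by move=> s [/andP[]].
have hi : has_inf S by split; [exists (1/6) | exists 0].
pose s0 := inf S.
have s0P : 0 <= s0 <= 1/6.
  by rewrite lb_le_inf ?ge_inf //; [exists 0 | exists (1/6)].
have cont : {within `[1, 2], continuous (h s0)}.
  apply: continuous_subspaceT; apply: (@lipschitz_continuous _ _ (3 ^+ q + 1)) => x y.
  have := iter_lift_lipschitz q x y (ha _ s0P); rewrite -/(G s0) /h.
  have := ler_norm (x - y); have := ler_norm (y - x); rewrite (distrC y x).
  by rewrite !ler_norml mulrDl mul1r; lra.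
have [t] := EVT_max (ltW (ltr1n R 2 : 1 < 2)) cont.
rewrite in_itv /= => t12 tmax.
(* Were the maximum negative at [s0], the Lipschitz bound in the parameter would keep it negative
   slightly above [s0]. *)
have ht0 : 0 <= h s0 t.
  rewrite leNgt; apply/negP => hneg.
  have [s [sP [t' t'P st']] ss0] : exists2 s, S s & s < s0 + - h s0 t / 4 ^+ q.
    by apply: inf_adherent => //; rewrite divr_gt0 // oppr_gt0.
  have ssge : s0 <= s by apply: ge_inf; [exists 0 | split=> //; exists t'].
  have := hs s s0 t' s0P; rewrite ger0_norm ?subr_ge0 //.
  have := tmax t'; rewrite in_itv => /(_ t'P).
  have : (s - s0) * 4 ^+ q < - h s0 t by rewrite -ltr_pdivlMr //; lra.
  by lra.
(* A positive excess at [s0 > 0] would survive a smaller parameter; at [s0 = 0] the bounds are still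
   [l], and the excess contradicts the rotation number. *)
have hle v : 1 <= v <= 2 -> h s0 v <= 0.
  move=> v12; rewrite leNgt; apply/negP => hpos.
  have [s00|s00] := eqVneq s0 0.
    have lE : raise l s0 = l.
      by apply: funext => d; rewrite /raise s00 max_l //; have := l0 d; lra.
    have : p%:R / q%:R <= rotation_number l.
      apply: (@rotation_number_ge_orbit _ l q p v) => //; first by lra.
      by move: hpos; rewrite /h /G lE; lra.
    by lra.
  have s0pos : 0 < s0 by rewrite lt_neqAle eq_sym s00; lra.
  pose s := Num.max 0 (s0 - h s0 v / 4 ^+ q).
  have dpos : 0 < h s0 v / 4 ^+ q by rewrite divr_gt0.
  have sP : 0 <= s < s0 by rewrite /s; split_minmax; lra.
  have sd : s0 - s <= h s0 v / 4 ^+ q by rewrite /s; split_minmax; lra.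
  have : s0 <= s.
    apply: ge_inf; [by exists 0 | split; first by lra].
    exists v => //; have sP' : 0 <= s <= 1/6 by lra.
    have := hs s0 s v sP'; rewrite ger0_norm; last by lra.
    by move: sd; rewrite ler_pdivlMr //; lra.
  by lra.
exists s0, t; split=> //; first by lra.
  by have := hle t t12; move: ht0; rewrite /h; lra.
move=> v v0; have := truncn_itv v0; set k := Num.truncn v => kP.
have := hle (v + 1 - k%:R); rewrite /h => H.
have {}H : iter q (G s0) (v + 1 - k%:R) <= v + 1 - k%:R + p%:R.
  by have := H ltac:(lra); lra.
have := @iter_lift_periodic _ _ q v 1 (ha _ s0P) v0.
have := @iter_lift_periodic _ _ q (v + 1 - k%:R) k (ha _ s0P).
rewrite subrK -/(G s0) => ->; last by lra.
by lra.
Qed.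

End Touch.

Definition steep (R : realType) (l : bool -> R) (d : bool) (u : R) : Prop :=
  forall v, 0 <= v < u -> half_lift l d v < half_lift l d u.

(** * Touching orbits avoid the flat pieces of the envelope *)

Section Cycles.
Variable R : realType.
Implicit Types (l K : bool -> R) (d : bool) (s t u v : R).

Lemma half_lift_gt0 l d u : admissible l -> 0 <= u ->
  half_lift l d 0 < half_lift l d u ->
  half_lift l d u = Num.min (3 * u)
    (Num.min (Num.max (3 * u - 1/2) (1/2 + l (~~ d))) (1/2 + 3 * l (~~ d))) /\
  Num.min (3 * l d) (1/2) < half_lift l d u.
Proof.
move=> l0 u0; have ? := l0 d; have ? := l0 (~~ d).
rewrite half_lift0; try lra.
move=> h; split=> //; move: h; rewrite /half_lift.
by rewrite lt_max ltxx /= => h; rewrite max_r // ltW.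
Qed.

(* In the third case [3 * u - 1/2] lies in the part [[0, l (~~ d)]] of the
   other side, which genuine orbits do not visit. *)
Lemma steep_cases l d u : admissible l -> 0 < u <= 1/2 -> steep l d u ->
  [\/ [/\ l d < u, 3 * u <= 1/2 & half_lift l d u = 3 * u],
      l (~~ d) < 3 * u - 1 /\ half_lift l d u = 3 * u - 1/2 |
      1/2 < 3 * u <= 1/2 + l (~~ d) /\ half_lift l d u = 3 * u].
Proof.
move=> l0 u0 st; have k0 := l0 (~~ d); have j0 := l0 d.
have [E m] : half_lift l d u = Num.min (3 * u)
    (Num.min (Num.max (3 * u - 1/2) (1/2 + l (~~ d))) (1/2 + 3 * l (~~ d))) /\
  Num.min (3 * l d) (1/2) < half_lift l d u.
  by apply: half_lift_gt0 => //; [lra | apply: st; lra].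
have ge v : Num.min (3 * v)
    (Num.min (Num.max (3 * v - 1/2) (1/2 + l (~~ d))) (1/2 + 3 * l (~~ d)))
    <= half_lift l d v by rewrite /half_lift le_max lexx orbT.
have [u6|u6] := leP (3 * u) (1/2).
  have E3 : half_lift l d u = 3 * u.
    by rewrite E; clear -k0 u0 u6; split_minmax; lra.
  apply: Or31; split=> //; move: m; rewrite E3; split_minmax; lra.
have [uk|uk] := leP (3 * u) (1/2 + l (~~ d)).
  by apply: Or33; split; [lra | rewrite E; clear -k0 u6 uk; split_minmax; lra].
have [uk'|uk'] := ltP (l (~~ d)) (3 * u - 1); last first.
  have E3 : half_lift l d u = 1/2 + l (~~ d).
    by rewrite E; clear -k0 uk uk'; split_minmax; lra.
  (* This is the left end of the plateau [1/2 + l (~~ d)]; it lies below [u] and has the same value,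
     against steepness. *)
  have : half_lift l d ((1/2 + l (~~ d)) / 3) < half_lift l d u by apply: st; lra.
  have := ge ((1/2 + l (~~ d)) / 3); rewrite E3.
  set m' := Num.min _ _; have -> : m' = 1/2 + l (~~ d).
    by rewrite /m'; clear -k0; split_minmax; lra.
  by lra.
have [uk3|uk3] := leP (3 * u - 1/2) (1/2 + 3 * l (~~ d)).
  by apply: Or32; split=> //; rewrite E; clear -k0 uk uk' uk3; split_minmax; lra.
have E3 : half_lift l d u = 1/2 + 3 * l (~~ d).
  by rewrite E; clear -k0 uk uk' uk3; split_minmax; lra.
(* Likewise the left end of the flat piece made by the cap. *)
have : half_lift l d ((1 + 3 * l (~~ d)) / 3) < half_lift l d u by apply: st; lra.
have := ge ((1 + 3 * l (~~ d)) / 3); rewrite E3.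
set m' := Num.min _ _; have -> : m' = 1/2 + 3 * l (~~ d).
  by rewrite /m'; clear -k0; split_minmax; lra.
by lra.
Qed.

Lemma cell_inj (c c' : nat) u u' : 0 <= u < 1/2 -> 0 <= u' < 1/2 ->
  c%:R / 2 + u = c'%:R / 2 + u' -> c = c' /\ u = u'.
Proof.
move=> u0 u0' e.
have cc : c = c'.
  apply/eqP; case: ltngtP => // cc; move: cc; rewrite -(ler_nat R); lra.
by subst c'; split=> //; lra.
Qed.

(** Cells are closed on the right here, so that a node is seen from its left, where [steep]
    looks. *)
Lemma cell_gt0 t : 0 < t -> exists (c : nat) u, 0 < u <= 1/2 /\ t = c%:R / 2 + u.
Proof.
move=> t0; have [c [u [u0 tE]]] := cellP (ltW t0).
have [u00|u00] := eqVneq u 0; last first.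
  by exists c, u; split=> //; move: u00; rewrite neq_lt; lra.
subst u; case: c tE => [|c] tE; first by lra.
by exists c, (1/2); split; [lra | rewrite tE; lra].
Qed.

Section Touching.
Variables (K : bool -> R) (p q : nat) (t : R).
Hypothesis (K0 : admissible K) (t1 : 1 <= t) (pq : (p.*2 < q)%N).
(** [K1] comes from passing to [core], and [K2] from a rotation number below [1/2]; together they
    exclude the third case of [steep_cases]. *)
Hypothesis K1 : forall d, 3 * K (~~ d) - 1 <= K d.
Hypothesis K2 : exists d, K d <= 1/6.
Hypothesis tq : iter q (circle_lift K) t = t + p%:R.
Hypothesis Kq : forall v, 0 <= v -> iter q (circle_lift K) v <= v + p%:R.
Let orb n := iter n (circle_lift K) t.

Let orb_ge1 n : 1 <= orb n.
Proof.
elim: n => //= n IH; have := @lift_ge_node R K 2 (orb n) K0.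
by rewrite divff //; apply.
Qed.

Let orb_period n : iter q (circle_lift K) (orb n) = orb n + p%:R.
Proof.
have t0 : 0 <= t := le_trans ler01 t1.
by rewrite /orb -iterD addnC iterD tq iter_lift_periodic.
Qed.

(* A flat piece to the left of an orbit point would give a displacement larger
   than [p]. *)
Let orb_strict n v : 0 <= v < orb n -> circle_lift K v < orb n.+1.
Proof.
move=> /andP[v0 vn].
have : circle_lift K v <= orb n.+1 by apply: lift_homo => //; exact: ltW.
rewrite le_eqVlt => /orP[/eqP e|//].
have q0 : (0 < q)%N by case: (q) pq.
have := Kq v0; rewrite -(prednK q0) iterSr e -[orb n.+1]/(circle_lift K (orb n)).
by rewrite -iterSr (prednK q0) orb_period; lra.
Qed.

Let orb_steep n c u : 0 < u <= 1/2 -> orb n = c%:R / 2 + u -> steep K (odd c) u.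
Proof.
move=> u0 nE v v0; have := @orb_strict n (c%:R / 2 + v).
rewrite -[orb n.+1]/(circle_lift K (orb n)) nE !liftE ?ltrD2l; try lra; try by [].
by apply; have := ler0n R c; lra.
Qed.

Let orbS n c u : 0 < u <= 1/2 -> orb n = c%:R / 2 + u ->
  orb n.+1 = c%:R / 2 + half_lift K (odd c) u.
Proof. by move=> u0 nE; rewrite /orb /= -/(orb n) nE liftE //; lra. Qed.

(** From the top of a cell, steepness leaves only the next node as image. The orbit would then
    advance by exactly [1/2] per step, hence by [q / 2 > p] in all. *)
Let orb_node n c : orb n != c%:R / 2.
Proof.
apply/eqP => nE.
have H m : orb (n + m) = (c + m)%:R / 2.
  elim: m => [|m IH]; first by rewrite !addn0.
  rewrite !addnS; move: IH; case: (c + m)%N => [|e] IH.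
    by have := orb_ge1 (n + m); lra.
  have e0 : 0 < (1/2 : R) <= 1/2 by lra.
  have eE : orb (n + m) = e%:R / 2 + 1/2 by rewrite IH; lra.
  rewrite (orbS e0 eE); have ? := K0 (~~ odd e).
  case: (steep_cases K0 e0 (orb_steep e0 eE)) => [[]|[_ ->]|[]]; lra.
have := H q; rewrite addnC /orb iterD -/(orb n) orb_period nE.
by move: pq; rewrite -(ltr_nat R) -mul2n natrM natrD; lra.
Qed.

Lemma touching_orbit_step n c u : 0 < u < 1/2 -> orb n = c%:R / 2 + u ->
  exists u', 0 < u' < 1/2 /\
    ([/\ orb n.+1 = c%:R / 2 + u', u' = 3 * u & K (odd c) < u] \/
     [/\ orb n.+1 = c.+1%:R / 2 + u', u' = 3 * u - 1 & K (~~ odd c) < u']).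
Proof.
move=> u01 nE; have u0 : 0 < u <= 1/2 by lra.
have S := orbS u0 nE; have k0 := K0 (odd c); have k1 := K0 (~~ odd c).
case: (steep_cases K0 u0 (orb_steep u0 nE)) => [[h1 h2 h3]|[h1 h3]|[h1 h3]].
- exists (3 * u); split; last by left; rewrite -h3.
  have := orb_node n.+1 c.+1; rewrite S h3 neq_lt; lra.
- exists (3 * u - 1); split; first by lra.
  by right; rewrite S h3; split=> //; lra.
(* In the third case the orbit enters the other side at depth at most [K (~~ odd c)]. There the
   first case fails, the second contradicts [K1], and only the third can recur. *)
exfalso.
have u0' : 0 < 3 * u - 1/2 <= 1/2 by lra.
have nE' : orb n.+1 = c.+1%:R / 2 + (3 * u - 1/2) by rewrite S h3; lra.
have S' := orbS u0' nE'.
have := K1 (odd c); have := steep_cases K0 u0' (orb_steep u0' nE').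
rewrite /= negbK => -[[]|[]|[g1 g3]]; try lra.
move=> _.
(* The depth just reached exceeds [1/6], so [K (~~ odd c)] does too and [K2] must concern the side
   [odd c]. The next depth is at most [1/6], where no case remains. *)
have k6 : K (odd c) <= 1/6.
  by have [d] := K2; case: (d) (odd c) k0 k1 h1 => -[] /=; lra.
have u0'' : 0 < 3 * (3 * u - 1/2) - 1/2 <= 1/2 by lra.
have nE'' : orb n.+2 = c.+2%:R / 2 + (3 * (3 * u - 1/2) - 1/2).
  by rewrite S' /= g3; lra.
have := steep_cases K0 u0'' (orb_steep u0'' nE'').
by rewrite /= negbK => -[[]|[]|[]]; lra.
Qed.

Lemma touching_orbit_cell : exists c u, 0 < u < 1/2 /\ t = c%:R / 2 + u.
Proof.
have t0 : 0 < t := lt_le_trans ltr01 t1.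
have [c [u [u0 tE]]] := cell_gt0 t0; exists c, u; split=> //.
by have := orb_node 0 c.+1; rewrite /orb /= tE neq_lt; lra.
Qed.

End Touching.
End Cycles.

(** * Genuine cycles from touching orbits *)

Section CycleExistence.
Variable R : realType.
Implicit Types (l K : bool -> R) (d : bool) (s t u v : R).

Lemma iter_lift_period l q p t n : admissible l -> 0 <= t ->
  iter q (circle_lift l) t = t + p%:R ->
  iter (n * q) (circle_lift l) t = t + (n * p)%:R.
Proof.
move=> l0 t0 tq; elim: n => [|n IH]; first by rewrite !mul0n addr0.
by rewrite !mulSn iterD IH iter_lift_periodic // tq natrD addrA.
Qed.

(** On the two surviving cases the envelope agrees with the interval map: after a crossing
    [3 * u - 1] exceeds [K >= l], so the plateau is not met. *)
Lemma touching_orbit_genuine l K p q c0 u0 n : admissible l -> admissible K ->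
  (forall d, l d <= K d) -> (p.*2 < q)%N ->
  (forall d, 3 * K (~~ d) - 1 <= K d) -> (exists d, K d <= 1/6) ->
  let t := c0%:R / 2 + u0 : R in 1 <= t -> 0 < u0 < 1/2 ->
  iter q (circle_lift K) t = t + p%:R ->
  (forall v, 0 <= v -> iter q (circle_lift K) v <= v + p%:R) ->
  let x := place (odd c0) u0 in
  let c := (c0 + or_count (fold_map l) n x)%N in
  exists u, [/\ 0 < u < 1/2, iter n (fold_map l) x = place (odd c) u &
    iter n (circle_lift K) t = c%:R / 2 + u].
Proof.
move=> l0 K0 lK pq K1 K2 t t1 u01 tq Kq x.
elim: n => [|n [u [u1 nE tE]]]; first by exists u0; rewrite /or_count /= addn0.
move: nE tE; rewrite or_countS; set c := (c0 + or_count _ n x)%N => nE tE.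
have [u' [u1' st]] := touching_orbit_step K0 t1 pq K1 K2 tq Kq u1 tE.
have H d' : (d' = odd c /\ u' = 3 * u /\ u' < 1/2) \/
    (d' = ~~ odd c /\ u' = 3 * u - 1 /\ K (~~ odd c) < u') ->
    fold_map l (place (odd c) u) = place d' u'.
  have ? := l0 (~~ odd c); have ? := lK (~~ odd c).
  case=> -[-> [uE h]]; rewrite fold_mapE //; try lra.
    by congr place; rewrite uE; split_minmax; lra.
  have -> : Num.min (3 * u) (Num.min (2 - 3 * u) (1 - l (~~ odd c))) = 1 - u'.
    by split_minmax; lra.
  by rewrite /place; case: odd => /=; lra.
exists u'; rewrite /= nE addnA -/c.
case: st => -[t'E uE Ku].
  have fE : fold_map l (place (odd c) u) = place (odd c) u'.
    by apply: H; left; do 2!split=> //; lra.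
  by rewrite (crossingE l0 u1 u1' fE) eqxx addn0.
have fE : fold_map l (place (odd c) u) = place (~~ odd c) u' by apply: H; right.
rewrite (crossingE l0 u1 u1' fE) (_ : odd c != ~~ odd c); last by case: odd.
by rewrite addn1.
Qed.

Lemma core_rotation_lt_half l : admissible l -> rotation_number l < 1/2 ->
  exists d, l d <= 1/6.
Proof.
move=> l0; apply: contraPP => /forallNP h.
have h6 d : 1/6 <= l d by have /negP := h d; rewrite -ltNge => /ltW.
have := @iter_lift_ge_half _ _ 2 0 l0 h6; rewrite mul0r add0n divff // => H.
have := @rotation_number_ge_orbit _ l 2 1 0 l0 isT (lexx _).
by rewrite add0r => /(_ H) ? /lt_geF; lra.
Qed.

Lemma over_rotation_exists l p q : admissible l -> (p.*2 < q)%N ->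
  rotation_number (core l) < p%:R / q%:R ->
  over_rotation_numbers (fold_map l) (p%:R / q%:R).
Proof.
move=> l0 pq rho; have q0 : (0 < q)%N by apply: leq_ltn_trans pq.
have q0R : 0 < q%:R :> R by rewrite ltr0n.
have L0 := core_admissible l0.
have [s [t [s6 t1 tq Kq]]] := first_touch L0 q0 (ltnW pq) rho.
set K := raise _ _ in tq Kq.
have K0 : admissible K by exact: raise_admissible.
have lK d : l d <= K d by rewrite /K /raise /core !le_max lexx.
have K1 d : 3 * K (~~ d) - 1 <= K d.
  rewrite /K /raise /core negbK; move: (l0 d) (l0 (~~ d)); split_minmax; lra.
have K2 : exists d, K d <= 1/6.
  have [|d Ld] := core_rotation_lt_half L0; last first.
    by exists d; rewrite /K /raise ge_max Ld; lra.
  apply: lt_trans rho _; rewrite ltr_pdivrMr //.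
  by move: pq; rewrite -(ltr_nat R) -mul2n natrM; lra.
have [c0 [u0 [u01 tE]]] := touching_orbit_cell K0 t1 pq tq Kq.
subst t; set t := _ + u0 in t1 tq Kq.
have gen n := @touching_orbit_genuine l K p q c0 u0 n l0 K0 lK pq K1 K2 t1 u01 tq Kq.
set x := place (odd c0) u0 in gen.
set cr := fun n => or_count (fold_map l) n x.
have qx : iter q (fold_map l) x = x.
  have [u [u1 -> ]] := gen q; rewrite tq => tE.
  have [cE <-] : (c0 + p.*2)%N = (c0 + cr q)%N /\ u0 = u.
    by apply: (@cell_inj R); [lra | lra | rewrite -tE /t -mul2n natrD natrM; lra].
  by rewrite -/(cr q) -cE oddD odd_double addbF.
have exq : exists n, (0 < n)%N && (iter n (fold_map l) x == x).
  by exists q; rewrite q0 qx eqxx.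
(* The least period [m] may be smaller than [q]; the ratio is unchanged, since advancing [q * m]
   steps in two ways gives [m * p = q * k]. *)
have [m /andP[m0 /eqP mx] mmin] := ex_minnP exq.
have fx : fold_map l x <> x.
  move=> fx; have [] := fold_map_gt (odd c0) l0 u01.
  by rewrite -/x fx subrr ltxx => h1 h2; rewrite -h2 in h1.
have m1 : (1 < m)%N.
  by rewrite ltn_neqAle m0 andbT; apply/eqP => m1; apply: fx; rewrite -[RHS]mx -m1.
have [u [u1 mE tm]] := gen m; rewrite -/(cr m) in mE tm.
have [dE uE] := place_inj u01 u1 (etrans (esym mx) mE); subst u.
have ev : ~~ odd (cr m) by move: dE; rewrite oddD; case: odd; case: odd.
have {ev} := even_halfK ev; set k := _./2 => kE.
have tmk : iter m (circle_lift K) t = t + k%:R.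
  by rewrite tm -kE /t -mul2n natrD natrM; lra.
have t0 : 0 <= t by lra.
have pm : (m * p = q * k)%N.
  have := iter_lift_period m K0 t0 tq; have := iter_lift_period q K0 t0 tmk.
  by rewrite mulnC => -> /addrI /eqP; rewrite eqr_nat => /eqP.
exists m, x; split=> //.
- by rewrite /x /place; case: odd; lra.
- split=> //; split=> // n /andP[n0 nm] nx.
  by have := mmin n; rewrite n0 nx eqxx leqNgt nm => /(_ isT).
rewrite /over_rotation_number -/(cr m) -kE -mul2n !natrM.
have m0R : 0 < m%:R :> R by rewrite ltr0n.
have : m%:R * p%:R = q%:R * k%:R :> R by rewrite -!natrM pm.
move=> e; apply/eqP; rewrite eqr_div ?mulf_neq0 ?pnatr_eq0 -?lt0n //.
by apply/eqP; lra.
Qed.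

End CycleExistence.

Lemma continuous_pair (T U V : topologicalType) (f : T -> U) (g : T -> V) :
  continuous f -> continuous g -> continuous (fun x => (f x, g x)).
Proof.
move=> fc gc x; apply: (@cvg_pair T U V (nbhs x) (nbhs (f x)) (nbhs (g x))).
  exact: fc.
exact: gc.
Qed.

(** * Connected level sets of monotone functions on the plane *)

Section LevelSet.
Variable R : realType.
Implicit Types (phi : R * R -> R) (s t : R).

(* Along [s |-> diag t s] the first coordinate decreases and the second
   increases, so a function monotone in this sense has a 1-Lipschitz first
   hitting time of [mu], and its level set is a thickening of that graph. *)
Definition diag t s : R * R := (t - s, t + s).

Lemma connected_monotone_level_set phi (mu : R) : continuous phi ->
  (forall x x' y y', x' <= x -> y <= y' -> phi (x, y) <= phi (x', y')) ->
  (forall t, exists s, phi (diag t s) < mu) ->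
  (forall t, exists s, mu < phi (diag t s)) ->
  connected [set z | phi z = mu].
Proof.
move=> phic phim lo hi.
have diagc t : continuous (diag t).
  apply: continuous_pair => s; first by apply: cvgB; [exact: cvg_cst | exact: cvg_id].
  by apply: cvgD; [exact: cvg_cst | exact: cvg_id].
have cdiag t : continuous (fun s => phi (diag t s)).
  by move=> s; apply: continuous_comp; [exact: diagc | exact: phic].
(* An increase of [s] by [|t - t'|] absorbs the change of [t] in both coordinates; this makes [m]
   below 1-Lipschitz. *)
have mono t t' s s' : s + `|t - t'| <= s' -> phi (diag t s) <= phi (diag t' s').
  move=> h; have := ler_norm (t - t'); have := ler_norm (t' - t).
  by rewrite (distrC t') => h1 h2; apply: phim; lra.
have monos t s s' : s <= s' -> phi (diag t s) <= phi (diag t s').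
  by move=> ss; apply: mono; rewrite subrr normr0 addr0.
pose E t := [set s | mu <= phi (diag t s)].
have Ehi t : has_inf (E t).
  split; first by have [s /ltW] := hi t; exists s.
  have [s hs] := lo t; exists s => s' /= Es'.
  rewrite leNgt; apply/negP => /ltW/(monos t) h.
  by have := lt_le_trans (le_lt_trans h hs) Es'; rewrite ltxx.
pose m t := inf (E t).
have Em t s : E t s -> m t <= s by move=> Es; apply: ge_inf => //; case: (Ehi t).
have Eup t s : m t < s -> E t s.
  move=> ms; have [s' Es' s's] : exists2 s', E t s' & s' < m t + (s - m t).
    by apply: inf_adherent => //; lra.
  by apply: le_trans Es' (monos _ _ _ _); lra.
have mlip t t' : m t' <= m t + `|t - t'|.
  rewrite leNgt; apply/negP => h.
  pose e := (m t' - (m t + `|t - t'|)) / 2.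
  have e0 : 0 < e by rewrite /e; lra.
  have Ee : E t (m t + e) by apply: Eup; lra.
  have : E t' (m t + e + `|t - t'|) by apply: le_trans Ee (mono _ _ _ _ _).
  by move/Em; move: h; rewrite /e; lra.
have mc : continuous m.
  apply: (@lipschitz_continuous R m 1) => x y; rewrite mul1r.
  by have := mlip x y; have := mlip y x; rewrite (distrC y) ler_norml; lra.
have mE t : phi (diag t (m t)) = mu.
  apply/eqP; case: ltgtP => // h.
    have /cvgrPdist_lt/(_ (mu - phi (diag t (m t)))) := cdiag t (m t).
    rewrite subr_gt0 => /(_ h) /nbhs_ballP[e /= e0 he].
    have Ee : E t (m t + e / 2) by apply: Eup; lra.
    have := he (m t + e / 2); rewrite /ball /= opprD addrA subrr sub0r normrN.
    rewrite gtr0_norm; last by lra.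
    have h2 : e / 2 < e by lra.
    by move/(_ h2); rewrite ltr_norml; move: Ee; rewrite /E /=; lra.
  have /cvgrPdist_lt/(_ (phi (diag t (m t)) - mu)) := cdiag t (m t).
  rewrite subr_gt0 => /(_ h) /nbhs_ballP[e /= e0 he].
  have := he (m t - e / 2); rewrite /ball /= opprB addrCA subrr addr0.
  rewrite gtr0_norm; last by lra.
  have h2 : e / 2 < e by lra.
  move/(_ h2); rewrite ltr_norml => h3.
  have : E t (m t - e / 2) by rewrite /E /=; lra.
  by move/Em; lra.
pose C := (fun t => diag t (m t)) @` setT.
have Cc : connected C.
  apply: connected_continuous_connected.
    by apply/connected_intervalP => x y _ _ z _.
  apply: continuous_subspaceT; apply: continuous_pair => t.
    by apply: cvgB; [exact: cvg_id | exact: mc].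
  by apply: cvgD; [exact: cvg_id | exact: mc].
(* By monotonicity [phi] is constant on the diagonal from the graph point at [m t] up to [z], so
   this segment joins [z] to [C]. *)
have seg z : phi z = mu -> exists A, [/\ connected A, A z, C `<=` A &
    A `<=` [set z | phi z = mu]].
  move=> pz; pose t := (z.1 + z.2) / 2; pose s := (z.2 - z.1) / 2.
  have zE : z = diag t s by rewrite [LHS]surjective_pairing /diag /t /s; congr pair; lra.
  have ms : m t <= s by apply: Em; rewrite /E /= -zE pz.
  exists (C `|` (diag t @` `[m t, s])); split.
  - apply: connectedU => //.
      exists (diag t (m t)); split; first by exists t.
      by exists (m t) => //; rewrite /= in_itv /= lexx.
    apply: connected_continuous_connected; first exact: segment_connected.
    exact: continuous_subspaceT (diagc t).
  - by right; exists s => //; rewrite /= in_itv /= lexx ms.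
  - by move=> w; left.
  - move=> w [[r _ <-]|[r]]; first exact: mE.
    rewrite /= in_itv /= => /andP[r1 r2] <-.
    by have := monos t _ _ r1; have := monos t _ _ r2; rewrite mE -zE pz; lra.
pose A z := if pselect (phi z = mu) is left h then sval (cid (seg z h)) else C.
have AP z : phi z = mu -> [/\ connected (A z), A z z, C `<=` A z &
    A z `<=` [set z | phi z = mu]].
  by move=> h; rewrite /A; case: pselect => // h'; case: cid.
have -> : [set z | phi z = mu] = \bigcup_(z in [set z | phi z = mu]) A z.
  apply/seteqP; split => z; first by move=> h; exists z => //; case: (AP z h).
  by move=> [w /AP[_ _ _ sub]]; exact: sub.
apply: bigcup_connected; last by move=> z /AP[].
exists (diag 0 (m 0)) => z /AP[_ _ sub _]; apply: sub; by exists 0.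
Qed.

End LevelSet.

(** * Identification of [psi] with the rotation number, and conclusion *)

Section OverRotation.
Variable R : realType.
Implicit Types (l : bool -> R) (d : bool) (z w : R * R).

Lemma rotation_number_ge0 l : admissible l -> 0 <= rotation_number l.
Proof.
move=> l0; apply: rotation_number_ge => n n0; rewrite divr_ge0 ?ler0n //.
by rewrite addr_ge0 ?iter_lift_ge0.
Qed.

Lemma ratio_between (x y : R) : 0 <= x -> x < y ->
  exists p q : nat, (0 < q)%N /\ x < p%:R / q%:R < y.
Proof.
move=> x0 xy; pose q := (Num.truncn (y - x)^-1).+1.
have q0 : 0 < q%:R :> R by rewrite ltr0n.
have qxy : 1 < q%:R * (y - x).
  by rewrite -ltr_pdivrMr ?subr_gt0 // div1r truncnS_gt.
exists (Num.truncn (x * q%:R)).+1, q; split=> //.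
rewrite ltr_pdivlMr // ltr_pdivrMr // truncnS_gt /=.
have : 0 <= x * q%:R by rewrite mulr_ge0 // ltW.
by move=> /truncn_itv; lra.
Qed.

Lemma inf_closure_eq (N : set R) (a : R) : (forall r, N r -> a <= r) ->
  (forall e, a < e -> exists2 r, N r & r < e) -> inf (closure N) = a.
Proof.
move=> lb ub.
have clb r : closure N r -> a <= r.
  have /closure_id cE : closed [set y : R | a <= y] by exact: closed_ge.
  by have : closure N `<=` [set y : R | a <= y];
    [rewrite cE; exact: closure_subset | apply].
have [r0 Nr0 _] := ub (a + 1) ltac:(lra).
have cl0 : has_lbound (closure N) by exists a => r; exact: clb.
apply/eqP; rewrite eq_le; apply/andP; split; last first.
  by apply: lb_le_inf => [|r]; [exists r0; exact: subset_closure | exact: clb].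
apply/ler_addgt0Pr => e e0; have [r Nr re] := ub (a + e) ltac:(lra).
apply: le_trans (ltW re); apply: ge_inf => //; exact: subset_closure.
Qed.

Definition sides z d : R := if d then 1 - z.1 else z.2.

Lemma sides_admissible z : Pspace z -> admissible (sides z).
Proof. by move=> [z1 z2] []; rewrite /sides /=; lra. Qed.

Lemma psi_fold z : psi z = inf (closure (over_rotation_numbers (fold_map (sides z)))).
Proof. by rewrite /psi /over_rotation_interval /fold_map /sides subKr. Qed.

Lemma over_rotation_numbers_ge l r : admissible l ->
  over_rotation_numbers (fold_map l) r -> rotation_number (core l) <= r.
Proof. by move=> l0 [q [x [q1 x01 cx ->]]]; exact: over_rotation_ge. Qed.

Lemma psi_rotation z : Pspace z -> rotation_number (core (sides z)) < 1/2 ->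
  psi z = rotation_number (core (sides z)).
Proof.
move=> Pz lt; have l0 := sides_admissible Pz; rewrite psi_fold.
apply: inf_closure_eq => [r|e he]; first exact: over_rotation_numbers_ge.
have r0 := rotation_number_ge0 (core_admissible l0).
(* The ratio is also kept below [1/2], as [over_rotation_exists] produces cycles only for
   [p.*2 < q]. *)
have [|p [q [q0 /andP[pq1]]]] := @ratio_between _ (Num.min e (1/2)) r0.
  by rewrite lt_min he.
rewrite lt_min => /andP[pe ph]; exists (p%:R / q%:R) => //.
apply: over_rotation_exists => //.
move: ph; rewrite ltr_pdivrMr ?ltr0n // => ph.
by rewrite -(ltr_nat R) -mul2n natrM; lra.
Qed.

(* Without cycles of period [> 1], [psi] is the junk value [inf set0 = 0]. *)
Lemma psi_rotation_ge z : Pspace z -> 1/2 <= rotation_number (core (sides z)) ->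
  psi z = 0 \/ 1/2 <= psi z.
Proof.
move=> Pz ge; have l0 := sides_admissible Pz; rewrite psi_fold.
have [->|/set0P N0] := eqVneq (over_rotation_numbers (fold_map (sides z))) set0.
  by left; rewrite closure0 inf0.
right; apply: lb_le_inf.
  by case: N0 => r Nr; exists r; exact: subset_closure.
have /closure_id cE : closed [set y : R | 1/2 <= y] by exact: closed_ge.
have sub : closure (over_rotation_numbers (fold_map (sides z))) `<=`
    [set y : R | 1/2 <= y].
  rewrite cE; apply: closure_subset => r Nr /=.
  exact: le_trans ge (over_rotation_numbers_ge l0 Nr).
by move=> r /sub.
Qed.

Lemma psi_level z (mu : R) : Pspace z -> 0 < mu < 1/2 ->
  psi z = mu <-> rotation_number (core (sides z)) = mu.
Proof.
move=> Pz mu0; split=> [pz|rz]; last by rewrite psi_rotation // rz; lra.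
have [lt|ge] := ltP (rotation_number (core (sides z))) (1/2).
  by rewrite -psi_rotation.
by case: (psi_rotation_ge Pz ge); rewrite pz; lra.
Qed.

(** The retraction of the plane onto [Pspace], which extends the rotation number to a monotone
    function on the whole plane. *)
Definition clamp_params z : R * R :=
  (Num.min 1 (Num.max (1/2) z.1), Num.min (1/2) (Num.max 0 z.2)).

Lemma clamp_paramsP z : Pspace (clamp_params z).
Proof. by rewrite /Pspace /clamp_params /=; split_minmax; lra. Qed.

Lemma clamp_params_id z : Pspace z -> clamp_params z = z.
Proof.
by case: z => x y [] /= ? ?; rewrite /clamp_params /=; congr pair; split_minmax; lra.
Qed.

Lemma clamp_params_continuous : continuous clamp_params.
Proof.
have c1 : continuous (cst 1 \min (cst (1/2) \max fst) : R * R -> R^o).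
  move=> z; apply: continuous_min; first exact: cvg_cst.
  by apply: continuous_max; [exact: cvg_cst | exact: cvg_fst].
have c2 : continuous (cst (1/2) \min (cst 0 \max snd) : R * R -> R^o).
  move=> z; apply: continuous_min; first exact: cvg_cst.
  by apply: continuous_max; [exact: cvg_cst | exact: cvg_snd].
exact: continuous_pair c1 c2.
Qed.

Lemma core_sides_lipschitz z w (e : R) : `|z.1 - w.1| <= e -> `|z.2 - w.2| <= e ->
  forall d, `|core (sides (clamp_params z)) d - core (sides (clamp_params w)) d| <= 3 * e.
Proof.
move=> h1 h2.
have H d : `|sides (clamp_params z) d - sides (clamp_params w) d| <= e.
  case: d; rewrite /sides /clamp_params /= ler_norml; move: h1 h2;
    rewrite !ler_norml => ? ?; split_minmax; lra.
move=> d; move: (H d) (H (~~ d)); rewrite /core !ler_norml; split_minmax; lra.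
Qed.

Definition param_rotation z : R := rotation_number (core (sides (clamp_params z))).

Lemma param_rotation_continuous : continuous param_rotation.
Proof.
move=> z; apply/cvgrPdist_lt => e e0.
have [dl dl0 H] := rotation_number_continuous e0.
have d3 : 0 < dl / 3 by rewrite divr_gt0.
apply: filterS (nbhsx_ballx z _ d3) => w [b1 b2].
have adm x := core_admissible (sides_admissible (clamp_paramsP x)).
apply: H => [||d]; [exact: adm | exact: adm |].
rewrite -[leRHS](_ : 3 * (dl / 3) = dl); last by lra.
by apply: core_sides_lipschitz; apply: ltW.
Qed.

Lemma param_rotation_le (x x' y y' : R) : x' <= x -> y <= y' ->
  param_rotation (x, y) <= param_rotation (x', y').
Proof.
move=> xx yy.
have adm w := core_admissible (sides_admissible (clamp_paramsP w)).
apply: rotation_number_homo => [||d]; [exact: adm | exact: adm |].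
have H c : sides (clamp_params (x, y)) c <= sides (clamp_params (x', y')) c.
  by rewrite /sides /clamp_params; case: c => /=; split_minmax; lra.
by move: (H d) (H (~~ d)); rewrite /core; split_minmax; lra.
Qed.

(** Far down the diagonal the parameters clamp to the corner [(1, 0)], where the bounds vanish and
    the lift fixes [0]. *)
Lemma param_rotation_low (t : R) : param_rotation (diag t (- (`|t| + 1))) <= 0.
Proof.
have := ler_norm t; have := ler_norm (- t); rewrite normrN => h1 h2.
rewrite /param_rotation; set L := core _.
have cE : clamp_params (diag t (- (`|t| + 1))) = (1, 0).
  by rewrite /clamp_params /diag /=; congr pair; split_minmax; lra.
have LE : L = fun=> 0.
  apply: funext => d; rewrite /L cE /core /sides.
  by case: d => /=; split_minmax; lra.
have L0 : admissible L by rewrite LE => d; lra.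
have L00 : circle_lift L 0 = 0.
  have := @liftE R L 0 0 L0; rewrite mul0r !add0r => -> /=; last by lra.
  by rewrite LE half_lift0 // mulr0 min_l // divr_ge0.
have := @rotation_number_le_orbit _ L 1 0 0 L0 isT (lexx _).
by rewrite mul0r; apply; rewrite /= L00 add0r.
Qed.

(** At the other end they clamp to [(1/2, 1/2)], where both bounds are at least [1/2]. *)
Lemma param_rotation_high (t : R) : 1/2 <= param_rotation (diag t (`|t| + 1)).
Proof.
have := ler_norm t; have := ler_norm (- t); rewrite normrN => h1 h2.
rewrite /param_rotation; set L := core _.
have L0 : admissible L := core_admissible (sides_admissible (clamp_paramsP _)).
rewrite leNgt; apply/negP => /(core_rotation_lt_half L0)[d].
have cE : clamp_params (diag t (`|t| + 1)) = (1/2, 1/2).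
  by rewrite /clamp_params /diag /=; congr pair; split_minmax; lra.
by rewrite /L cE /core /sides; case: d => /=; split_minmax; lra.
Qed.

End OverRotation.

Theorem mainTheorem2 (R : realType) (mu : R) :
  irrational mu -> 0 <= mu <= 1/2 ->
  connected [set p : R * R | Pspace p /\ psi p = mu].
Proof.
move=> irr mu01.
(* Irrationality excludes the two values at which [psi] and the rotation number may have different
   level sets. *)
have mu0 : mu <> 0 by move=> m; apply: irr; exists 0; rewrite ?raddf0.
have mu1 : mu <> 1/2.
  by move=> m; apply: irr; exists (1/2); rewrite // m fmorph_div rmorph1 ratr_nat.
have {mu01 mu0 mu1} muP : 0 < mu < 1/2.
  have /andP[a b] := mu01; rewrite !lt_neqAle a b eq_sym.
  by move/eqP: mu0 => ->; move/eqP: mu1 => ->.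
have -> : [set p : R * R | Pspace p /\ psi p = mu] =
    (@clamp_params R) @` [set z | param_rotation z = mu].
  apply/seteqP; split=> [z [Pz /(psi_level Pz muP) rz]|_ [z /= rz <-]].
    by exists z => /=; rewrite ?/param_rotation ?clamp_params_id.
  have Pc := clamp_paramsP z; split=> //; exact/(psi_level Pc muP).
apply: connected_continuous_connected; last first.
  exact: continuous_subspaceT (@clamp_params_continuous R).
apply: connected_monotone_level_set.
- exact: param_rotation_continuous.
- exact: param_rotation_le.
- by move=> t; exists (- (`|t| + 1)); have := param_rotation_low t; lra.
- by move=> t; exists (`|t| + 1); have := param_rotation_high t; lra.
Qed.
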